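(* The theories $T(S_0)$ and $T(S_1)$ are not definitionally equivalent.
   Context: Work in the first-order language with one constant symbol $0$, one unary function symbol $s$, and one unary relation symbol $R$. Write $s^0(x)=x$, $s^{n+1}(x)=s(s^n(x))$. For $S\subseteq\omega$ let $T(S)=\{R(s^n(0)) : n\in S\}\cup\{\neg R(s^n(0)) : n\notin S\}\cup \mathrm{Th}(\langle\omega,0,s\rangle)$, where $\langle\omega,0,s\rangle$ is the natural numbers with zero and successor. Build an infinite sequence over $\{0,1,x\}$ indexed by $\omega$ as follows: for $n=1,2,3,\dots$ in turn, write all $2^n$ sequences of $0$s and $1$s of length $n$ one after another in lexicographic (alphabetical) order, then write one symbol $x$; the sequence begins $0,1,x,0,0,0,1,1,0,1,1,x,0,0,0,\dots$. $S_0\subseteq\omega$ is the set whose characteristic function is obtained from this sequence by replacing every $x$ by $0$, and $S_1$ is obtained by replacing every $x$ by $1$. Two theories are definitionally equivalent if there are copies of them (obtained by renaming symbols) with disjoint languages having a common definitional extension. *)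

(* Defs.v *)
From mathcomp Require Import all_boot.
From mathcomp Require Import boolp classical_sets.

Set Implicit Arguments.
Unset Strict Implicit.
Unset Printing Implicit Defensive.

Local Open Scope classical_set_scope.

Definition of_ord0 (D : Type) (i : 'I_0) : D :=
  let: Ordinal _ lt_i0 := i in False_rect D (notF lt_i0).

Definition scons (D : Type) (n : nat) (d : D) (v : 'I_n -> D) (i : 'I_n.+1) : D :=
  if unlift ord0 i is Some j then v j else d.

(** * First-order logic with equality *)

(* Constant symbols are the function symbols of arity 0. *)
Record language := Language {
  fsym : Type;
  farity : fsym -> nat;
  rsym : Type;
  rarity : rsym -> nat
}.

(* [term L n] and [formula L n] have their free variables among [n] de Bruijn
   indices; [fAll] binds index 0 and shifts the other ones up.  Disjunction and
   existential quantification are the usual classical abbreviations. *)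
Inductive term (L : language) (n : nat) : Type :=
| tVar of 'I_n
| tApp (f : fsym L) of 'I_(farity f) -> term L n.

Inductive formula (L : language) (n : nat) : Type :=
| fEq of term L n & term L n
| fRel (r : rsym L) of 'I_(rarity r) -> term L n
| fBot
| fAnd of formula L n & formula L n
| fImp of formula L n & formula L n
| fAll of formula L n.+1.

Arguments tVar {L n} _.
Arguments tApp {L n} f _.
Arguments fEq {L n} _ _.
Arguments fRel {L n} r _.
Arguments fBot {L n}.
Arguments fAnd {L n} _ _.
Arguments fImp {L n} _ _.
Arguments fAll {L n} _.

Definition fNot (L : language) (n : nat) (phi : formula L n) := fImp phi fBot.
Definition fIff (L : language) (n : nat) (phi psi : formula L n) :=
  fAnd (fImp phi psi) (fImp psi phi).

Fixpoint forall_closure (L : language) (n : nat) : formula L n -> formula L 0 :=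
  if n is m.+1 then fun phi => forall_closure (fAll phi) else id.

Definition sentence (L : language) := formula L 0.
Definition theory (L : language) := set (sentence L).

Record structure (L : language) := Structure {
  carrier :> Type;
  carrier_inhabited : inhabited carrier;
  fint : forall f : fsym L, ('I_(farity f) -> carrier) -> carrier;
  rint : forall r : rsym L, ('I_(rarity r) -> carrier) -> Prop
}.

Fixpoint eval (L : language) (M : structure L) (n : nat) (v : 'I_n -> M)
    (t : term L n) : M :=
  match t with
  | tVar i => v i
  | tApp f a => fint (fun i => eval v (a i))
  end.

Fixpoint sat (L : language) (M : structure L) (n : nat) (v : 'I_n -> M)
    (phi : formula L n) : Prop :=
  match phi with
  | fEq t u => eval v t = eval v u
  | fRel r a => rint (fun i => eval v (a i))
  | fBot => False
  | fAnd p q => sat v p /\ sat v q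
  | fImp p q => sat v p -> sat v q
  | fAll p => forall d : M, sat (scons d v) p
  end.

Definition holds (L : language) (M : structure L) (phi : sentence L) : Prop :=
  sat (@of_ord0 M) phi.

Definition model (L : language) (T : theory L) (M : structure L) : Prop :=
  forall phi, T phi -> holds M phi.

Definition logically_equivalent (L : language) (T T' : theory L) : Prop :=
  forall M : structure L, model T M <-> model T' M.

Definition Th (L : language) (M : structure L) : theory L :=
  [set phi | holds M phi].

(** * Renaming of symbols and definitional equivalence *)

(* An embedding renames the symbols of [L] injectively to symbols of [L']; its
   image is a copy of [L] sitting inside [L'] as a sublanguage. *)
Record embedding (L L' : language) := Embedding {
  ef : fsym L -> fsym L';
  er : rsym L -> rsym L';
  ef_arity : forall f, farity (ef f) = farity f;
  er_arity : forall r, rarity (er r) = rarity r;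
  ef_inj : injective ef;
  er_inj : injective er
}.

Fixpoint trename (L L' : language) (e : embedding L L') (n : nat)
    (t : term L n) : term L' n :=
  match t with
  | tVar i => tVar i
  | tApp f a =>
      tApp (ef e f) (fun i => trename e (a (cast_ord (ef_arity e f) i)))
  end.

Fixpoint rename (L L' : language) (e : embedding L L') (n : nat)
    (phi : formula L n) : formula L' n :=
  match phi with
  | fEq t u => fEq (trename e t) (trename e u)
  | fRel r a =>
      fRel (er e r) (fun i => trename e (a (cast_ord (er_arity e r) i)))
  | fBot => fBot
  | fAnd p q => fAnd (rename e p) (rename e q)
  | fImp p q => fImp (rename e p) (rename e q)
  | fAll p => fAll (rename e p)
  end.

Definition copy (L L' : language) (e : embedding L L') (T : theory L) : theory L' :=
  [set rename e phi | phi in T].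

(* forall x, P(x) <-> phi(x) *)
Definition rel_definition (L L' : language) (e : embedding L L') (r : rsym L')
    (phi : formula L (rarity r)) : sentence L' :=
  forall_closure (fIff (fRel r (fun i => tVar i)) (rename e phi)).

(* forall x y, f(x) = y <-> phi(x, y), where y is the variable of index 0 *)
Definition fun_definition (L L' : language) (e : embedding L L') (f : fsym L')
    (phi : formula L (farity f).+1) : sentence L' :=
  forall_closure (fIff (fEq (tApp f (fun i => tVar (lift ord0 i))) (tVar ord0))
                (rename e phi)).

(* T |= forall x, exists! y, phi(x, y) *)
Definition defines_function (L : language) (T : theory L) (k : nat)
    (phi : formula L k.+1) : Prop :=
  forall M : structure L, model T M ->
  forall a : 'I_k -> M, exists! b : M, sat (scons b a) phi.

(* [T'] is a definitional extension of the copy of [T] along [e]: up to logical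
   equivalence, it adds to that copy one admissible explicit definition, by a
   formula of the copied language, for each symbol outside that language.  The
   values of [dF] and [dR] at the other symbols are irrelevant. *)
Definition definitional_extension (L L' : language) (e : embedding L L')
    (T : theory L) (T' : theory L') : Prop :=
  exists (dF : forall f : fsym L', formula L (farity f).+1)
         (dR : forall r : rsym L', formula L (rarity r)),
    (forall f, ~ range (ef e) f -> defines_function T (dF f)) /\
    logically_equivalent T'
      (copy e T
       `|` [set fun_definition e (dF f) | f in ~` range (ef e)]
       `|` [set rel_definition e (dR r) | r in ~` range (er e)]).

Definition disjoint_embeddings (L1 L2 L : language)
    (e1 : embedding L1 L) (e2 : embedding L2 L) : Prop :=
  range (ef e1) `&` range (ef e2) = set0 /\
  range (er e1) `&` range (er e2) = set0.

Definition definitionally_equivalent (L1 L2 : language)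
    (T1 : theory L1) (T2 : theory L2) : Prop :=
  exists (L : language) (e1 : embedding L1 L) (e2 : embedding L2 L),
    disjoint_embeddings e1 e2 /\
    exists T : theory L,
      definitional_extension e1 T1 T /\ definitional_extension e2 T2 T.

(** * The theories T(S) *)

Inductive succ_fsym := zero_sym | succ_sym.

Definition succ_farity (f : succ_fsym) : nat :=
  if f is succ_sym then 1 else 0.

Definition L_succ : language :=
  {| fsym := succ_fsym; farity := succ_farity;
     rsym := void; rarity := fun _ => 0 |}.

Definition L_succR : language :=
  {| fsym := succ_fsym; farity := succ_farity;
     rsym := unit; rarity := fun _ => 1 |}.

Definition L_succ_incl : embedding L_succ L_succR :=
  @Embedding L_succ L_succR id (fun r : void => match r with end)
    (fun _ => erefl) (fun r : void => match r with end)
    (fun _ _ => id) (fun r : void => match r with end).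

Definition omega_succ : structure L_succ :=
  @Structure L_succ nat (inhabits 0)
    (fun f => match f return ('I_(succ_farity f) -> nat) -> nat with
              | zero_sym => fun _ => 0
              | succ_sym => fun a => (a ord0).+1
              end)
    (fun r : void => match r with end).

Definition tZero : term L_succR 0 :=
  @tApp L_succR 0 zero_sym (@of_ord0 (term L_succR 0)).

Definition tSucc (t : term L_succR 0) : term L_succR 0 :=
  @tApp L_succR 0 succ_sym (fun _ => t).

Definition R_numeral (n : nat) : sentence L_succR :=
  @fRel L_succR 0 tt (fun _ => iter n tSucc tZero).

Definition T_of (S : set nat) : theory L_succR :=
  [set R_numeral n | n in S]
  `|` [set fNot (R_numeral n) | n in ~` S]
  `|` copy L_succ_incl (Th omega_succ).

(** * The sets S0 and S1 *)

(* All binary words of length [n], in lexicographic order. *)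
Fixpoint words (n : nat) : seq (seq bool) :=
  if n is m.+1 then map (cons false) (words m) ++ map (cons true) (words m)
  else [:: [::]].

(* The letters 0, 1, x are [Some false], [Some true], [None]. *)
Definition block (n : nat) : seq (option bool) :=
  rcons (map Some (flatten (words n))) None.

(* Blocks are nonempty, so blocks 1, ..., i+1 cover the index [i]. *)
Definition letter (i : nat) : option bool :=
  nth None (flatten [seq block n | n <- iota 1 i.+1]) i.

Definition S0 : set nat := [set i | odflt false (letter i)].
Definition S1 : set nat := [set i | odflt true (letter i)].

(* Main.v *)
(* Definitional equivalence would turn the standard model of T(S0) into a model of
   T(S1) on the same carrier, whose successor [g], zero [z] and predicate [R] are
   definable in it.  Every finite window of S0 recurs, so by an
   Ehrenfeucht-Fraisse argument definable relations are local: outside a finite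
   set, [g] moves a point by a bounded amount that depends only on the window of
   S0 around it, and [R] is read off such a window.  In the long runs of 0s at
   the beginning of each block, [g] is therefore a translation, and counting
   makes it [x |-> x + 1]; as [g] is acyclic, the first [p] iterates of [g] from
   [z] are exactly the numbers below [p] for [p] in such a run.  So [R] and S1
   have the same number of elements below [p], and agree at [p].

   Write the 2^n words of length n cyclically.  For each j, the words of length n
   that start at the j-th letter of some word are again all 2^n words, each once:
   a local rule is true a multiple of n times per turn.  In S0 the separator only
   adds one more window of 0s, on which [R] is false, so [R] has a multiple of n
   elements between the starts of two successive blocks.  For S1 this number is
   1 modulo n, because of the letter x. *)
From mathcomp Require Import all_boot zify.
From mathcomp Require Import boolp classical_sets.
Require Import Defs.

Set Implicit Arguments.
Unset Strict Implicit.
Unset Printing Implicit Defensive.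

Local Open Scope classical_set_scope.

(** * Expansions by definitions *)

Lemma scons_ord0 (D : Type) (n : nat) (d : D) (v : 'I_n -> D) :
  scons d v ord0 = d.
Proof. by rewrite /scons unlift_none. Qed.

Lemma scons_lift (D : Type) (n : nat) (d : D) (v : 'I_n -> D) (i : 'I_n) :
  scons d v (lift ord0 i) = v i.
Proof. by rewrite /scons liftK. Qed.

Lemma scons_eta (D : Type) (n : nat) (v : 'I_n.+1 -> D) :
  scons (v ord0) (fun i => v (lift ord0 i)) = v.
Proof.
apply: funext => i; case: (unliftP ord0 i) => [j ->|->].
  by rewrite scons_lift.
by rewrite scons_ord0.
Qed.

Lemma holds_forall_closure (L : language) (M : structure L) (n : nat)
    (phi : formula L n) :
  holds M (forall_closure phi) <-> forall v : 'I_n -> M, sat v phi.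
Proof.
elim: n phi => [|n IHn] phi.
  split=> [sat_phi v|]; last exact.
  by rewrite (_ : v = @of_ord0 M) //; apply: funext => -[].
rewrite /= IHn; split=> [sat_phi v|sat_phi v d]; last exact: sat_phi.
by rewrite -(scons_eta v); apply: sat_phi.
Qed.

Definition reduct (L L' : language) (e : embedding L L') (M : structure L') :
    structure L :=
  @Structure L M (carrier_inhabited M)
    (fun f a => @fint L' M (ef e f) (fun i => a (cast_ord (ef_arity e f) i)))
    (fun r a => @rint L' M (er e r) (fun i => a (cast_ord (er_arity e r) i))).

Lemma eval_trename (L L' : language) (e : embedding L L') (M : structure L')
    (n : nat) (v : 'I_n -> M) (t : term L n) :
  @eval L (reduct e M) n v t = eval v (trename e t).
Proof.
by elim: t => [//|f a IHa] /=; congr fint; apply: funext => i; apply: IHa.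
Qed.

Lemma sat_rename (L L' : language) (e : embedding L L') (M : structure L')
    (n : nat) (v : 'I_n -> M) (phi : formula L n) :
  @sat L (reduct e M) n v phi <-> sat v (rename e phi).
Proof.
elim: phi v => {n} [n t u|n r a|n|n p IHp q IHq|n p IHp q IHq|n p IHp] v /=.
- by rewrite !eval_trename.
- by under boolp.eq_fun do rewrite eval_trename.
- by [].
- by rewrite IHp IHq.
- by rewrite IHp IHq.
- by split=> H d; move: (H d); rewrite IHp.
Qed.

(** Casting arguments along arity equations leaves interpretations that agree only pointwise;
    extensionality then identifies the two structures. *)
Lemma sat_interp_ext (L : language) (M : structure L)
    (F : forall f : fsym L, ('I_(farity f) -> M) -> M)
    (P : forall r : rsym L, ('I_(rarity r) -> M) -> Prop) :
  (forall f a, F f a = fint a) -> (forall r a, P r a = rint a) ->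
  forall (n : nat) (v : 'I_n -> M) (phi : formula L n),
  @sat L (Structure (carrier_inhabited M) F P) n v phi <-> sat v phi.
Proof.
move=> eqF eqP; have -> : F = @fint L M.
  by apply: functional_extensionality_dep => f; apply: funext.
have -> : P = @rint L M.
  by apply: functional_extensionality_dep => r; apply: funext.
by case: M {F P eqF eqP}.
Qed.

Section Expansion.
Variables (L L' : language) (e : embedding L L') (M : structure L).
Variable F : forall f : fsym L', ('I_(farity f) -> M) -> M.
Variable P : forall r : rsym L', ('I_(rarity r) -> M) -> Prop.

Lemma farity_preimage (g : fsym L) (f : fsym L') :
  ef e g = f -> farity g = farity f.
Proof. by move=> <-; rewrite ef_arity. Qed.

Lemma rarity_preimage (g : rsym L) (r : rsym L') :
  er e g = r -> rarity g = rarity r.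
Proof. by move=> <-; rewrite er_arity. Qed.

Definition expansion : structure L' :=
  @Structure L' M (carrier_inhabited M)
    (fun f => match pselect (exists g, ef e g = f) with
              | left h => fun a => let: exist g eq_g := cid h in
                  @fint L M g (fun i => a (cast_ord (farity_preimage eq_g) i))
              | right _ => @F f
              end)
    (fun r => match pselect (exists g, er e g = r) with
              | left h => fun a => let: exist g eq_g := cid h in
                  @rint L M g (fun i => a (cast_ord (rarity_preimage eq_g) i))
              | right _ => @P r
              end).

Lemma fint_expansion (f : fsym L') :
  ~ range (ef e) f -> @fint L' expansion f = @F f.
Proof.
by move=> nef /=; case: pselect => // -[g eq_g]; case: nef; exists g.
Qed.

Lemma rint_expansion (r : rsym L') :
  ~ range (er e) r -> @rint L' expansion r = @P r.
Proof.
by move=> ner /=; case: pselect => // -[g eq_g]; case: ner; exists g.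
Qed.

(** Injectivity of [e] forces the preimage picked by [cid] to be the original symbol, so the reduct
    of [expansion] along [e] is [M] up to casts. *)
Lemma sat_expansion (n : nat) (v : 'I_n -> M) (phi : formula L n) :
  @sat L' expansion n v (rename e phi) <-> sat v phi.
Proof.
rewrite -[X in X <-> _](sat_rename e (M := expansion)).
apply: sat_interp_ext => [f|r] a /=.
  case: pselect => [h|[]]; last by exists f.
  case: cid => g eq_gf; have eq_g := ef_inj eq_gf; subst g.
  by congr fint; apply: funext => i; congr a; apply: val_inj.
case: pselect => [h|[]]; last by exists r.
case: cid => g eq_gr; have eq_g := er_inj eq_gr; subst g.
by congr rint; apply: funext => i; congr a; apply: val_inj.
Qed.

End Expansion.

(** Renaming preserves arities only propositionally, so defining formulas have to be transported. *)
Lemma graph_definition_cast (L : language) (M : structure L) (k k' : nat)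
    (eq_k : k = k') (phi : formula L k.+1) :
  exists psi : formula L k'.+1, forall (a : 'I_k' -> M) (b : M),
    sat (scons b a) psi <-> sat (scons b (fun i => a (cast_ord eq_k i))) phi.
Proof.
subst k'; exists phi => a b.
by rewrite (_ : (fun i => _) = a) //; apply: funext => i; rewrite cast_ord_id.
Qed.

Lemma relation_definition_cast (L : language) (M : structure L) (k k' : nat)
    (eq_k : k = k') (phi : formula L k) :
  exists psi : formula L k', forall a : 'I_k' -> M,
    sat a psi <-> sat (fun i => a (cast_ord eq_k i)) phi.
Proof.
subst k'; exists phi => a.
by rewrite (_ : (fun i => _) = a) //; apply: funext => i; rewrite cast_ord_id.
Qed.

(* The model of [T2] lives on the carrier of [M]: it is the reduct to the second
   language of the expansion of [M] by the definitions of the common theory. *)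
Lemma definable_model (L1 L2 : language) (T1 : theory L1) (T2 : theory L2)
    (M : structure L1) :
  definitionally_equivalent T1 T2 -> model T1 M ->
  exists (F : forall f : fsym L2, ('I_(farity f) -> M) -> M)
         (P : forall r : rsym L2, ('I_(rarity r) -> M) -> Prop),
    [/\ model T2 (Structure (carrier_inhabited M) F P),
        forall f, exists phi : formula L1 (farity f).+1,
          forall a b, F f a = b <-> sat (scons b a) phi &
        forall r, exists phi : formula L1 (rarity r),
          forall a, P r a <-> sat a phi].
Proof.
move=> [L [e1 [e2 [[disj_f disj_r] [T [ext1 ext2]]]]]] modM.
have [dF [dP [dF_fun equivT]]] := ext1.
have [dF2 [dP2 [_ equivT2]]] := ext2.
have [d] := carrier_inhabited M.
have [F0 F0P] : exists F0 : forall f : fsym L, ('I_(farity f) -> M) -> M,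
    forall f, ~ range (ef e1) f ->
      forall a b, F0 f a = b <-> sat (scons b a) (dF f).
  exists (fun f => match pselect (~ range (ef e1) f) with
    | left nf => fun a => sval (cid (dF_fun f nf M modM a))
    | right _ => fun=> d end).
  move=> f nf a b; case: pselect => // nf'; case: cid => c [dFc uniq_c] /=.
  by split=> [<-//|/uniq_c].
pose P0 (r : rsym L) (a : 'I_(rarity r) -> M) := sat a (dP r).
pose N := expansion e1 F0 P0.
have modN : model T N.
  apply/equivT => _ [[[phi T1phi <-]|[f nf <-]]|[r nr <-]].
  - by apply/(sat_expansion e1 F0 P0)/modM.
  - apply/holds_forall_closure => v.
    rewrite -[v in sat v _]scons_eta; set b := v _; set a := fun i => v _.
    suff: @fint L N f a = b <-> @sat L N _ (scons b a) (rename e1 (dF f)).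
      rewrite -[X in fint X](_ : (fun i => scons b a (lift ord0 i)) = a);
        last by apply: funext => i; rewrite scons_lift.
      by rewrite -[X in _ = X](scons_ord0 b a); case.
    by rewrite (fint_expansion F0 P0 nf) F0P // (sat_expansion e1 F0 P0).
  - apply/holds_forall_closure => v.
    suff: @rint L N r v <-> @sat L N _ v (rename e1 (dP r)).
      by case=> H1 H2; split.
    by rewrite (rint_expansion F0 P0 nr) (sat_expansion e1 F0 P0).
move/equivT2 : modN => modN2.
exists (@fint L2 (reduct e2 N)), (@rint L2 (reduct e2 N)); split.
- move=> phi T2phi; apply/(sat_rename e2 (M := N)).
  by apply: modN2; left; left; exists phi.
- move=> f.
  (* Disjointness puts each symbol of the second language outside the image of the first, where [N]
     follows the definitions. *)
  have nf : ~ range (ef e1) (ef e2 f).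
    by move=> rf; have: set0 (ef e2 f) by rewrite -disj_f; split=> //; exists f.
  have [psi psiP] := @graph_definition_cast L1 M _ _ (ef_arity e2 f) (dF (ef e2 f)).
  by exists psi => a b; rewrite psiP -F0P // -(fint_expansion F0 P0 nf).
- move=> r.
  have nr : ~ range (er e1) (er e2 r).
    by move=> rr; have: set0 (er e2 r) by rewrite -disj_r; split=> //; exists r.
  have [psi psiP] := @relation_definition_cast L1 M _ _ (er_arity e2 r) (dP (er e2 r)).
  by exists psi => a; rewrite psiP -[X in _ <-> X]/(P0 _ _) -(rint_expansion F0 P0 nr).
Qed.

(** * Locality of definable relations *)

Definition omega_succR (S : set nat) : structure L_succR :=
  @Structure L_succR nat (inhabits 0) (@fint L_succ omega_succ)
    (fun _ a => S (a ord0)).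

(** The equation avoids truncated subtraction; an offset that leaves the natural numbers on either
    side imposes nothing. *)
Definition same_window (S : set nat) (r x x' : nat) : Prop :=
  forall y y', y + x' = y' + x -> x <= y + r -> y <= x + r -> (S y <-> S y').

Definition recurrent (S : set nat) : Prop :=
  forall r x N, r <= x -> exists2 x', N < x' & same_window S r x x'.

(* An [r]-local partial isomorphism of [omega_succR S], given by its graph:
   the winning positions of the Ehrenfeucht-Fraisse game. *)
Definition local_iso (S : set nat) (r : nat) (s : seq (nat * nat)) : Prop :=
  [/\ (0, 0) \in s,
      forall a a' b b', (a, a') \in s -> (b, b') \in s ->
        (a <= b + r /\ b <= a + r) \/ (a' <= b' + r /\ b' <= a' + r) ->
        a + b' = a' + b &
      forall a a', (a, a') \in s -> same_window S r a a'].

Definition swap_pairs (s : seq (nat * nat)) := [seq (p.2, p.1) | p <- s].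

Lemma mem_swap_pairs (s : seq (nat * nat)) (a a' : nat) :
  ((a, a') \in swap_pairs s) = ((a', a) \in s).
Proof.
apply/mapP/idP => [[[b b'] sb [-> ->]] //|sa]; by exists (a', a).
Qed.

Lemma local_iso_swap (S : set nat) (r : nat) (s : seq (nat * nat)) :
  local_iso S r s -> local_iso S r (swap_pairs s).
Proof.
move=> [s00 dist wind]; split=> [|a a' b b'|a a'].
- by rewrite mem_swap_pairs.
- by rewrite !mem_swap_pairs => sa sb; have := dist _ _ _ _ sa sb; lia.
- rewrite mem_swap_pairs => sa y y' eq_y le1 le2.
  by rewrite (wind _ _ sa y' y); lia || split.
Qed.

Lemma local_iso_le (S : set nat) (r r' : nat) (s : seq (nat * nat)) :
  r <= r' -> local_iso S r' s -> local_iso S r s.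
Proof.
move=> le_r [s00 dist wind]; split=> // [a a' b b' sa sb H|a a' sa y y' eq_y H1 H2].
  by apply: (dist _ _ _ _ sa sb); lia.
by apply: (wind _ _ sa); lia.
Qed.

(** The forth step of the game. If [d] is within [2 * r] of a played point, it moves along with that
    point, whose [3 * r] window contains the [r] window of [d]. Otherwise recurrence supplies a copy
    beyond all earlier answers. *)
Lemma local_iso_extend (S : set nat) (r : nat) (s : seq (nat * nat)) (d : nat) :
  recurrent S -> local_iso S (3 * r) s ->
  exists d', local_iso S r ((d, d') :: s).
Proof.
move=> recS [s00 dist wind].
suff [d' [distd windd]] : exists d',
    (forall a a', (a, a') \in s ->
      (a <= d + r /\ d <= a + r) \/ (a' <= d' + r /\ d' <= a' + r) ->
      a + d' = a' + d) /\ same_window S r d d'.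
  exists d'; split.
  - by rewrite inE s00 orbT.
  - move=> a a' b b'; rewrite !inE.
    move=> /orP[/eqP[-> ->]|sa] /orP[/eqP[-> ->]|sb] H.
    + lia.
    + by have := distd _ _ sb; lia.
    + by have := distd _ _ sa; lia.
    + by have := dist _ _ _ _ sa sb; lia.
  - move=> a a'; rewrite inE => /orP[/eqP[-> ->] //|sa] y y' eq_y H1 H2.
    by apply: (wind _ _ sa); lia.
case: (pselect (exists p, p \in s /\ (p.1 <= d + 2 * r /\ d <= p.1 + 2 * r))).
  move=> [[b b'] /= [sb [H1 H2]]].
  (* The pair [(0, 0)] fixes every played point within [3 * r] of 0, so the subtraction below is not
     truncated. *)
  have := dist _ _ _ _ sb s00 => sb0.
  exists (b' + d - b); split=> [a a' sa H|y y' eq_y H3 H4].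
    by have := dist _ _ _ _ sa sb; lia.
  by apply: (wind _ _ sb); lia.
move=> far.
have {far} far a a' : (a, a') \in s -> ~ (a <= d + 2 * r /\ d <= a + 2 * r).
  by move=> sa H; apply: far; exists (a, a').
(* Being far from the played point 0, [d] has its whole window inside the natural numbers, as
   recurrence requires. *)
have [|d' lt_d' windd] := recS r d (\max_(p <- s) p.2 + r).
  by have := far _ _ s00; lia.
exists d'; split=> // a a' sa.
have : a' <= \max_(p <- s) p.2.
  by rewrite (big_rem _ sa) /= leq_maxl.
by have := far _ _ sa; lia.
Qed.

Lemma eval_omega_succR (S : set nat) (n : nat) (t : term L_succR n) :
  exists (oi : option 'I_n) (k : nat), forall v : 'I_n -> nat,
    @eval _ (omega_succR S) n v t = (if oi is Some i then v i else 0) + k.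
Proof.
elim: t => [i|[] a IHa]; first by exists (Some i), 0 => v; rewrite addn0.
  by exists None, 0.
have [oi [k evk]] := IHa ord0.
by exists oi, k.+1 => v /=; rewrite evk addnS.
Qed.

(** An equation [x + k = y + l] only concerns points at distance at most [k + l], and each
    quantifier triples the radius. The back direction of the game follows from the forth direction
    by swapping pairs. *)
Lemma sat_local (S : set nat) (n : nat) (phi : formula L_succR n) :
  recurrent S ->
  exists r, forall s, local_iso S r s -> forall v v' : 'I_n -> nat,
    (forall i, (v i, v' i) \in s) ->
    @sat _ (omega_succR S) n v phi <-> @sat _ (omega_succR S) n v' phi.
Proof.
move=> recS.
elim: phi => {n} [n t u|n r a|n|n p [r1 IHp] q [r2 IHq]|n p [r1 IHp] q [r2 IHq]|
  n p [r IHp]].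
- have [oi [k evt]] := eval_omega_succR S t.
  have [oj [l evu]] := eval_omega_succR S u.
  exists (k + l) => s [s00 dist _] v v' sv /=; rewrite !evt !evu.
  have mem o : (if o is Some i then v i else 0, if o is Some i then v' i else 0) \in s.
    by case: o.
  have := dist _ _ _ _ (mem oi) (mem oj); lia.
- have [oi [k evt]] := eval_omega_succR S (a ord0).
  exists k => s [s00 _ wind] v v' sv /=; rewrite !evt.
  have mem o : (if o is Some i then v i else 0, if o is Some i then v' i else 0) \in s.
    by case: o.
  by apply: (wind _ _ (mem oi)); lia.
- by exists 0.
- exists (maxn r1 r2) => s iso v v' sv /=.
  rewrite (IHp s (local_iso_le _ iso) v v') ?(IHq s (local_iso_le _ iso) v v') //;
  lia.
- exists (maxn r1 r2) => s iso v v' sv /=.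
  rewrite (IHp s (local_iso_le _ iso) v v') ?(IHq s (local_iso_le _ iso) v v') //;
  lia.
- exists (3 * r).
  suff imp s : local_iso S (3 * r) s -> forall v v' : 'I_n -> nat,
      (forall i, (v i, v' i) \in s) ->
      @sat _ (omega_succR S) n v (fAll p) -> @sat _ (omega_succR S) n v' (fAll p).
    move=> s iso v v' sv; split; first exact: imp iso _ _ sv.
    apply: imp (local_iso_swap iso) _ _ _ => i.
    by rewrite mem_swap_pairs.
  move=> iso v v' sv /= satp d'.
  have [d /local_iso_swap iso'] := local_iso_extend d' recS (local_iso_swap iso).
  apply/(IHp _ iso' (scons d v)); last exact: satp.
  move=> i; rewrite mem_swap_pairs inE mem_swap_pairs.
  case: (unliftP ord0 i) => [j ->|->]; last by rewrite !scons_ord0 eqxx.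
  by rewrite !scons_lift sv orbT.
Qed.

(** * The blocks *)

Lemma size_words (n : nat) : size (words n) = 2 ^ n.
Proof. by elim: n => //= n IHn; rewrite size_cat !size_map IHn expnS; lia. Qed.

Lemma size_word (n k : nat) : k < 2 ^ n -> size (nth [::] (words n) k) = n.
Proof.
elim: n k => [[]|n IHn k lt_k] //=.
rewrite nth_cat size_map size_words; case: ifP => lt_kn.
  by rewrite (nth_map [::]) ?size_words //= IHn.
by rewrite (nth_map [::]) ?size_words /= ?IHn //; rewrite expnS in lt_k; lia.
Qed.

Lemma mem_words (w : seq bool) : w \in words (size w).
Proof.
elim: w => [//|b w IHw] /=; rewrite mem_cat.
by case: b; rewrite !(map_f _ IHw) ?orbT.
Qed.

(** Lexicographic order makes the [k]-th word the [n]-digit binary expansion of [k], most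
    significant digit first. *)
Definition digit (n k j : nat) : bool := odd (k %/ 2 ^ (n.-1 - j)).

Lemma odd_divn_pow2 (a b c q : nat) :
  a < b -> odd ((q * 2 ^ b + c) %/ 2 ^ a) = odd (c %/ 2 ^ a).
Proof.
move=> lt_ab; have -> : 2 ^ b = 2 ^ (b - a) * 2 ^ a by rewrite -expnD; congr expn; lia.
by rewrite mulnA divnMDl ?expn_gt0 // oddD oddM oddX subn_eq0 leqNgt lt_ab andbF.
Qed.

Lemma nth_word (n k j : nat) :
  k < 2 ^ n -> j < n -> nth false (nth [::] (words n) k) j = digit n k j.
Proof.
rewrite /digit; elim: n k j => [//|n IHn] k j lt_k lt_j /=.
rewrite nth_cat size_map size_words; case: ifP => lt_kn.
  rewrite (nth_map [::]) ?size_words //=.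
  case: j lt_j => [|j] lt_j /=; first by rewrite subn0 divn_small.
  by rewrite IHn //; congr (odd (_ %/ 2 ^ _)); lia.
have lt_k' : k - 2 ^ n < 2 ^ n by rewrite expnS in lt_k; lia.
rewrite (nth_map [::]) ?size_words //.
have -> : k = 1 * 2 ^ n + (k - 2 ^ n) by lia.
rewrite {1}mul1n addnC addnK.
case: j lt_j => [|j] lt_j /=.
  by rewrite subn0 divnMDl ?expn_gt0 // divn_small.
by rewrite IHn // odd_divn_pow2 ?subn1; [congr (odd (_ %/ 2 ^ _))|]; lia.
Qed.

Lemma nth_flatten_uniform (T : Type) (x0 : T) (n : nat) (ss : seq (seq T))
    (k j : nat) :
  (forall i, i < size ss -> size (nth [::] ss i) = n) -> k < size ss -> j < n ->
  nth x0 (flatten ss) (k * n + j) = nth x0 (nth [::] ss k) j.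
Proof.
elim: ss k => [//|s ss IHss] k size_ss lt_k lt_j /=.
have size_s := size_ss 0 isT; rewrite /= in size_s.
case: k lt_k => [|k] lt_k /=; rewrite nth_cat size_s; first by rewrite lt_j.
rewrite ifN; last by rewrite mulSn; lia.
rewrite mulSn (_ : n + k * n + j - n = k * n + j); last lia.
by apply: IHss => // i; apply: (size_ss i.+1).
Qed.

Lemma size_flatten_words (n : nat) : size (flatten (words n)) = 2 ^ n * n.
Proof.
rewrite size_flatten sumnE big_map (big_nth [::]) size_words.
rewrite (eq_big_nat _ _ (F2 := fun=> n)) => [|k lt_k]; last exact: size_word.
by rewrite sum_nat_const_nat subn0.
Qed.

Definition block_start (n : nat) : nat :=
  size (flatten [seq block k | k <- iota 1 n.-1]).

Lemma size_block (n : nat) : size (block n) = (2 ^ n * n).+1.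
Proof. by rewrite /block size_rcons size_map size_flatten_words. Qed.

Lemma block_startS (n : nat) :
  0 < n -> block_start n.+1 = block_start n + (2 ^ n * n).+1.
Proof.
case: n => // n _; rewrite /block_start -[n.+2.-1]addn1 iotaD map_cat flatten_cat.
by rewrite size_cat /= cats0 add1n size_block.
Qed.

Lemma leq_block_start (n : nat) : n <= (block_start n).+1.
Proof. by elim: n => // -[//|n] IHn; rewrite block_startS //; lia. Qed.

Lemma letter_block (n t : nat) :
  0 < n -> t <= 2 ^ n * n -> letter (block_start n + t) = nth None (block n) t.
Proof.
move=> n_gt0 le_t; rewrite /letter.
(* The blocks flattened by [letter] reach at least block [n]. *)
have [m ->] : exists m, (block_start n + t).+1 = n.-1 + m.+1.
  by exists (block_start n + t - n.-1); have := leq_block_start n; lia.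
rewrite iotaD map_cat flatten_cat nth_cat -/(block_start n) ifN; last by lia.

by rewrite addKn add1n prednK //= nth_cat size_block ltnS le_t.
Qed.

Lemma letter_word (n k j : nat) :
  k < 2 ^ n -> j < n -> letter (block_start n + (k * n + j)) = Some (digit n k j).
Proof.
move=> lt_k lt_j.
have lt_t : k * n + j < 2 ^ n * n by nia.
rewrite letter_block; [|lia|lia].
rewrite nth_rcons size_map size_flatten_words lt_t.
rewrite (nth_map false) ?size_flatten_words // nth_flatten_uniform ?size_words //.
  by rewrite nth_word.
by move=> i; apply: size_word.
Qed.

Lemma letter_separator (n : nat) :
  0 < n -> letter (block_start n + 2 ^ n * n) = None.
Proof.
move=> n_gt0; rewrite letter_block // /block nth_rcons size_map size_flatten_words.
by rewrite ltnn eqxx.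
Qed.

(** The window, prolonged to a word of length [n], is one of the words of block [n]; including [N]
    in [n] pushes that block beyond [N]. *)
Lemma recurrent_S0 : recurrent S0.
Proof.
move=> r x N le_rx; pose n := (2 * r).+2 + N.
pose w := mkseq (fun i => odflt false (letter (x - r + i))) n.
pose k := index w (words n).
have w_words : w \in words n by have := mem_words w; rewrite size_mkseq.
have lt_k : k < 2 ^ n by rewrite -size_words index_mem.
exists (block_start n + (k * n + r)).
  by have := leq_block_start n; lia.
move=> y y' eq_y le_xy le_yx.
have -> : y' = block_start n + (k * n + (y + r - x)) by lia.
rewrite /S0 /= letter_word //=; last lia.
rewrite -nth_word ?nth_index ?nth_mkseq //; try lia.
by rewrite (_ : x - r + _ = y); last lia.
Qed.

(** * The words of length [n] read cyclically *)

Definition cyclic_block (n t : nat) : bool :=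
  digit n ((t %/ n) %% 2 ^ n) (t %% n).

Lemma cyclic_block_period (n t : nat) :
  0 < n -> cyclic_block n (t + 2 ^ n * n) = cyclic_block n t.
Proof.
by move=> n_gt0; rewrite /cyclic_block addnC divnMDl // modnMDl modnDl.
Qed.

(** The first two words, 0...00 and 0...01, contribute [n] and [n - 1] zeros. *)
Lemma cyclic_block_small (n t : nat) :
  t < 2 * n - 1 -> cyclic_block n t = false.
Proof.
case: n => [|n]; first by lia.
move=> lt_t; rewrite /cyclic_block /digit /=.
case: (ltnP t n.+1) => [lt_tn|le_nt].
  by rewrite (divn_small lt_tn) mod0n div0n.
have -> : t = 1 * n.+1 + (t - n.+1) by lia.
rewrite divnMDl // [(t - _) %/ _]divn_small; last lia.
rewrite modnMDl [(t - _) %% _]modn_small; last lia.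
rewrite addn0; case: n lt_t le_nt => [|n] lt_t le_nt; first lia.
rewrite modn_small; last by rewrite -{1}(expn0 2) ltn_exp2l.
by rewrite divn_small // -{1}(expn0 2) ltn_exp2l //; lia.
Qed.

Lemma letter_cyclic_block (n t : nat) : t < 2 ^ n * n ->
  letter (block_start n + t) = Some (cyclic_block n t).
Proof.
case: n => [|n] lt_t; first by lia.
have lt_q : t %/ n.+1 < 2 ^ n.+1 by rewrite ltn_divLR.
by rewrite {1}(divn_eq t n.+1) letter_word ?ltn_mod // /cyclic_block (modn_small lt_q).
Qed.

Lemma S1_cyclic_block (n t : nat) : t < 2 ^ n * n ->
  S1 (block_start n + t) = cyclic_block n t.
Proof. by move=> lt_t; rewrite /S1 /= letter_cyclic_block. Qed.

Lemma S1_separator (n : nat) : 0 < n -> S1 (block_start n + 2 ^ n * n) = true.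
Proof. by move=> n_gt0; rewrite /S1 /= letter_separator. Qed.

(** Past the end of the block, [S0] shows the separator 0 and the initial zeros of the next block,
    while the cyclic block shows its own initial zeros: the two readings still agree there. *)
Lemma S0_cyclic_block (n t : nat) : t < 2 ^ n * n + 2 * n - 1 ->
  S0 (block_start n + t) = cyclic_block n t.
Proof.
case: n => [|n] lt_t; first by lia.
case: (ltnP t (2 ^ n.+1 * n.+1)) => [lt_tQ|le_t].
  by rewrite /S0 /= letter_cyclic_block.
pose u := t - 2 ^ n.+1 * n.+1.
rewrite -[t in RHS](subnK le_t) cyclic_block_period // -/u cyclic_block_small; last lia.
case: (posnP u) => [u0|u_gt0].
  by rewrite (_ : t = 2 ^ n.+1 * n.+1) /S0 /= ?letter_separator //; lia.
have -> : block_start n.+1 + t = block_start n.+2 + u.-1.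
  by rewrite [block_start n.+2]block_startS //; lia.
rewrite /S0 /= letter_cyclic_block /= ?cyclic_block_small //; first lia.
apply: leq_trans (_ : 2 * n.+2 <= _); first lia.
by rewrite leq_pmul2r // expnS leq_pmulr // expn_gt0.
Qed.

(* The word of length [n] read in the cyclic block from letter [j] of its [k]-th
   word on: the low [n - j] bits of [k], then the high [j] bits of [k + 1]. *)
Definition straddle (n j k : nat) : nat :=
  (k %% 2 ^ (n - j)) * 2 ^ j + (k.+1 %% 2 ^ n) %/ 2 ^ (n - j).

Lemma straddle_high_lt (n j k : nat) :
  j <= n -> (k.+1 %% 2 ^ n) %/ 2 ^ (n - j) < 2 ^ j.
Proof.
by move=> le_jn; rewrite ltn_divLR ?expn_gt0 // -expnD subnKC // ltn_pmod ?expn_gt0.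
Qed.

Lemma straddle_lt (n j k : nat) : j <= n -> straddle n j k < 2 ^ n.
Proof.
move=> le_jn; have lt_C := straddle_high_lt k le_jn.
have : (k %% 2 ^ (n - j)).+1 * 2 ^ j <= 2 ^ n.
  by rewrite -[n in X in _ <= X](subnK le_jn) expnD
    leq_pmul2r ?expn_gt0 // ltn_pmod ?expn_gt0.
by rewrite mulSn; apply: leq_trans; rewrite /straddle addnC ltn_add2r.
Qed.

(** Division by [2 ^ j] recovers the low [n - j] bits of [k] and the high [j] bits of [k + 1]. The
    former also fix the low bits of [k + 1], hence [k + 1] modulo [2 ^ n]. *)
Lemma straddle_inj (n j k k' : nat) :
  j <= n -> k < 2 ^ n -> k' < 2 ^ n -> straddle n j k = straddle n j k' -> k = k'.
Proof.
move=> le_jn lt_k lt_k' eq_h.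
have lt_C := straddle_high_lt k le_jn; have lt_C' := straddle_high_lt k' le_jn.
have eqA : k = k' %[mod 2 ^ (n - j)].
  by have := congr1 (divn^~ (2 ^ j)) eq_h; rewrite /straddle !divnMDl ?expn_gt0 //
    (divn_small lt_C) (divn_small lt_C') !addn0.
have eqC : k.+1 %% 2 ^ n %/ 2 ^ (n - j) = k'.+1 %% 2 ^ n %/ 2 ^ (n - j).
  by have := congr1 (modn^~ (2 ^ j)) eq_h; rewrite /straddle !modnMDl
    (modn_small lt_C) (modn_small lt_C').
have dvd : 2 ^ (n - j) %| 2 ^ n by rewrite dvdn_exp2l // leq_subr.
have eqK : k.+1 = k'.+1 %[mod 2 ^ n].
  rewrite (divn_eq (k.+1 %% _) (2 ^ (n - j))) (divn_eq (k'.+1 %% _) (2 ^ (n - j))).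
  rewrite eqC !modn_dvdm //; congr (_ + _).
  by rewrite -(addn1 k) -(addn1 k') -modnDml eqA modnDml.
move/eqP: eqK; rewrite -(addn1 k) -(addn1 k') eqn_modDr !modn_small //.
by move/eqP.
Qed.

Lemma digit_straddle (n j k i : nat) :
  j < n -> k < 2 ^ n -> i < n ->
  cyclic_block n (k * n + j + i) = digit n (straddle n j k) i.
Proof.
move=> lt_jn lt_k lt_in; have n_gt0 : 0 < n by lia.
have lt_C := straddle_high_lt k (ltnW lt_jn).
rewrite /cyclic_block -addnA; case: (ltnP (j + i) n) => [lt_ji|le_ji].
  rewrite divnMDl // modnMDl divn_small // addn0 !modn_small // /digit /straddle.
  have -> : n.-1 - i = j + (n.-1 - (j + i)) by lia.
  rewrite expnD divnMA divnMDl ?expn_gt0 // (divn_small lt_C) addn0.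
  by rewrite {1}(divn_eq k (2 ^ (n - j))) odd_divn_pow2 //; lia.
have -> : k * n + (j + i) = k.+1 * n + (j + i - n) by rewrite mulSn; lia.
rewrite divnMDl // modnMDl divn_small; last lia.
rewrite addn0 (modn_small (_ : j + i - n < n)); last lia.
rewrite /digit /straddle odd_divn_pow2; last lia.
by rewrite -divnMA -expnD; congr (odd (_ %/ 2 ^ _)); lia.
Qed.

(** Split positions as [k * n + j]. For fixed [j], [straddle n j] permutes the word indices, so the
    sum over [k] does not depend on [j] and is counted [n] times. *)
Lemma dvdn_window_sum (n : nat) (G : (nat -> bool) -> nat) :
  (forall u u', (forall i, i < n -> u i = u' i) -> G u = G u') ->
  n %| \sum_(0 <= t < 2 ^ n * n) G (fun i => cyclic_block n (t + i)).
Proof.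
move=> G_ext; rewrite big_nat_mul.
under eq_bigr => k _.
  rewrite -{1}[k * n]add0n -addn1 mulnDl mul1n big_addn addKn.
  over.
rewrite exchange_big_nat /= (eq_big_nat _ _
  (F2 := fun=> \sum_(V < 2 ^ n) G (digit n V))); last first.
  move=> j lt_jn; rewrite big_mkord.
  have h_lt (k : 'I_(2 ^ n)) : straddle n j k < 2 ^ n by rewrite straddle_lt 1?ltnW.
  rewrite [RHS](reindex_inj (h := fun k => Ordinal (h_lt k))); last first.
    move=> k k' [eq_h]; apply: val_inj; apply: straddle_inj eq_h => //; exact: ltnW.
  apply: eq_bigr => k _; apply: G_ext => i lt_in.
  by rewrite -digit_straddle // [_ + j]addnC.
by rewrite sum_nat_const_nat subn0 dvdn_mulr.
Qed.

(** * Orbits, and models of T(S) *)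

Section Orbit.
Variables (g : nat -> nat) (z p : nat).
Hypothesis g_inj : injective g.
Hypothesis g_surj : forall y, y != z -> exists x, g x = y.
Hypothesis g_acyclic : forall x k, iter k.+1 g x != x.
Hypothesis g_cut : forall x, g x <= p -> x < p.

Lemma iter_orbit_inj (x i j : nat) : iter i g x = iter j g x -> i = j.
Proof.
wlog le_ij : i j / i <= j => [IH eq_ij|].
  by case/orP: (leq_total i j) => le_ij; [|symmetry]; apply: IH.
have cancel_iter k y : iter k g x = iter k g y -> x = y.
  by elim: k => //= k IHk /g_inj.
rewrite -{1}(subnK le_ij) addnC iterD => /cancel_iter.
case Dk: (j - i) => [|k]; first by move=> _; lia.
by move/esym/eqP; rewrite (negPf (g_acyclic _ _)).
Qed.

(** Walk backwards from [w]: by [g_cut] the walk stays at or below [p], and by acyclicity it never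
    repeats a point. It must therefore stop, which happens only at [z]. *)
Lemma reach_prefix (w : nat) : w <= p -> exists2 j, j <= p & iter j g z = w.
Proof.
move=> le_wp.
have back m : (exists2 j, j < m & iter j g z = w) \/
    exists x, iter m g x = w /\ forall i, i <= m -> iter i g x <= p.
  elim: m => [|m [[j lt_jm <-]|[x [eq_w le_p]]]].
  - by right; exists w; split=> // i; rewrite leqn0 => /eqP->.
  - by left; exists j => //; apply: ltnW.
  - have [x_z|/g_surj[x' eq_x]] := eqVneq x z.
      by left; exists m => //; rewrite -x_z.
    right; exists x'; split; first by rewrite iterSr eq_x.
    case=> [_|i le_im]; last by rewrite iterSr eq_x le_p.
    by apply/ltnW/g_cut; rewrite eq_x (le_p 0).
have [//|[x [_ le_p]]] := back p.+1.
have : size [seq iter i g x | i <- iota 0 p.+2] <= size (iota 0 p.+1).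
  apply: uniq_leq_size.
    by rewrite map_inj_uniq ?iota_uniq //; apply: iter_orbit_inj.
  by move=> y /mapP[i]; rewrite !mem_iota => lt_i ->; rewrite ltnS le_p.
by rewrite size_map !size_iota ltnn.
Qed.

(** The first [p + 1] iterates cover the [p + 1] numbers up to [p], hence are exactly these. If [p]
    were not the last one, [g p] would also be at most [p], against [g_cut]. *)
Lemma orbit_prefix :
  iter p g z = p /\ perm_eq [seq iter j g z | j <- iota 0 p] (iota 0 p).
Proof.
pose s := [seq iter j g z | j <- iota 0 p.+1].
have sub_s : {subset iota 0 p.+1 <= s}.
  move=> w; rewrite mem_iota ltnS => /reach_prefix[j le_jp <-].
  by apply/mapP; exists j; rewrite // mem_iota ltnS.
have [_ eq_s] := uniq_min_size (iota_uniq 0 p.+1) sub_s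
  (eq_leq (size_map _ _)).
have iter_p : iter p g z = p.
  have [j le_jp eq_p] := reach_prefix (leqnn p).
  have [lt_jp|le_pj] := ltnP j p; last first.
    by move: eq_p; rewrite (_ : j = p); last lia.
  have : iter j.+1 g z \in s by apply/mapP; exists j.+1; rewrite ?mem_iota.
  by rewrite -eq_s mem_iota => /(@g_cut (iter j g z)); rewrite eq_p ltnn.
split=> //.
have : perm_eq s (iota 0 p.+1).
  apply: uniq_perm (iota_uniq _ _) _ => [|w]; last by rewrite eq_s.
  by rewrite map_inj_uniq ?iota_uniq //; apply: iter_orbit_inj.
by rewrite /s -addn1 iotaD map_cat /= iter_p add0n perm_cat2r.
Qed.
End Orbit.

(** * Properties of successor as first-order sentences *)

Lemma sat_fIff (L : language) (M : structure L) (n : nat) (v : 'I_n -> M)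
    (phi psi : formula L n) :
  sat v (fIff phi psi) <-> (sat v phi <-> sat v psi).
Proof. by []. Qed.

Section SuccessorSentences.
Variable A : structure L_succ.
Let z : A := @fint _ A zero_sym (@of_ord0 A).
Let g (x : A) : A := @fint _ A succ_sym (fun=> x).

Definition tzero (n : nat) : term L_succ n :=
  @tApp L_succ n zero_sym (@of_ord0 (term L_succ n)).
Definition tsucc (n : nat) (t : term L_succ n) : term L_succ n :=
  @tApp L_succ n succ_sym (fun=> t).

Lemma eval_tzero (n : nat) (v : 'I_n -> A) : eval v (tzero n) = z.
Proof. by rewrite /=; congr fint; apply: funext => -[]. Qed.

Lemma eval_iter_tsucc (n k : nat) (v : 'I_n -> A) (t : term L_succ n) :
  eval v (iter k (@tsucc n) t) = iter k g (eval v t).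
Proof. by elim: k => //= k ->. Qed.

Definition succ_inj_sentence : sentence L_succ :=
  fAll (fAll (fImp
    (fEq (tsucc (tVar ord0)) (tsucc (tVar (lift ord0 ord0))))
    (fEq (tVar ord0) (tVar (lift ord0 ord0))))).

Lemma holds_succ_inj : holds A succ_inj_sentence <-> injective g.
Proof.
split=> [H x y eq_g|g_inj x y /=].
  by have := H y x; rewrite /= scons_lift !scons_ord0; apply.
by rewrite scons_lift !scons_ord0; apply: g_inj.
Qed.

Definition succ_range_sentence : sentence L_succ :=
  fAll (fIff (fNot (fEq (tVar ord0) (tzero 1)))
    (fNot (fAll (fNot (fEq (tsucc (tVar ord0)) (tVar (lift ord0 ord0))))))).

Lemma holds_succ_range :
  holds A succ_range_sentence <-> forall y, y <> z <-> exists x, g x = y.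
Proof.
have satE y : sat (scons y (@of_ord0 A)) (fIff (fNot (fEq (tVar ord0) (tzero 1)))
    (fNot (fAll (fNot (fEq (tsucc (tVar ord0)) (tVar (lift ord0 ord0))))))) <->
    (y <> z <-> exists x, g x = y).
  rewrite sat_fIff.
  have -> : sat (scons y (@of_ord0 A)) (fNot (fEq (tVar ord0) (tzero 1))) = (y <> z).
    by rewrite -[LHS]/(eval _ _ = eval _ _ -> False) eval_tzero /= scons_ord0.
  have -> : sat (scons y (@of_ord0 A))
      (fNot (fAll (fNot (fEq (tsucc (tVar ord0)) (tVar (lift ord0 ord0)))))) =
      exists x, g x = y.
    apply: propext; split=> /= [H|[x eq_x] H].
      apply: contrapT => nex; apply: H => x; rewrite scons_lift !scons_ord0 => eq_x.
      by apply: nex; exists x.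
    by apply: (H x); rewrite scons_lift !scons_ord0.
  by [].
by split=> H y; apply/satE/H.
Qed.

Definition acyclic_sentence (k : nat) : sentence L_succ :=
  fAll (fNot (fEq (iter k.+1 (@tsucc 1) (tVar ord0)) (tVar ord0))).

Lemma holds_acyclic (k : nat) :
  holds A (acyclic_sentence k) <-> forall x, iter k.+1 g x <> x.
Proof.
have satE x : sat (scons x (@of_ord0 A))
    (fNot (fEq (iter k.+1 (@tsucc 1) (tVar ord0)) (tVar ord0))) =
    (iter k.+1 g x <> x).
  by rewrite -[LHS]/(eval _ _ = eval _ _ -> False) eval_iter_tsucc /= scons_ord0.
by split=> H x; move: (H x); rewrite -satE.
Qed.
End SuccessorSentences.

Lemma model_T_of_omega (S : set nat) : model (T_of S) (omega_succR S).
Proof.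
have eval_numeral n : @eval _ (omega_succR S) 0 (@of_ord0 nat) (iter n tSucc tZero) = n.
  by elim: n => //= n ->.
move=> _ [[[n Sn <-]|[n nSn <-]]|[phi Th_phi <-]].
- by rewrite /holds /= eval_numeral.
- by rewrite /holds /= eval_numeral.
- apply/(sat_rename L_succ_incl (M := omega_succR S)).
  pose A := reduct L_succ_incl (omega_succR S).
  have [|[]|_] := @sat_interp_ext _ omega_succ (@fint _ A) (@rint _ A) _ _ _
    (@of_ord0 nat) phi; last exact.
  move=> f a.
  by congr fint; apply: funext => i; congr a; apply: val_inj.
Qed.

(** The first three properties are sentences, or a family of sentences indexed by [k], true in
    [omega_succ]; the last comes from the literals on numerals. *)
Lemma model_T_of_interp (S : set nat) (N : structure L_succR) :
  let z : N := @fint _ N zero_sym (@of_ord0 N) in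
  let g (x : N) : N := @fint _ N succ_sym (fun=> x) in
  model (T_of S) N ->
  [/\ injective g, forall y, y <> z <-> exists x, g x = y,
      forall x k, iter k.+1 g x <> x &
      forall n, @rint _ N tt (fun=> iter n g z) <-> S n].
Proof.
move=> z g modN; pose A := reduct L_succ_incl N.
have holdsA phi : holds omega_succ phi -> holds A phi.
  by move=> Hphi; apply/(sat_rename L_succ_incl (M := N))/modN; right; exists phi.
have zE : @fint _ A zero_sym (@of_ord0 A) = z.
  by rewrite /z /=; congr fint; apply: funext => -[].
have omega_iter k x : iter k (fun y => y.+1) x = k + x by elim: k => //= k ->.
split.
- by apply/(holds_succ_inj A)/holdsA/holds_succ_inj => x y [].
- rewrite -zE; apply/(holds_succ_range A)/holdsA/holds_succ_range => -[|y].
    by split=> [//|[]].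
  by split=> // _; exists y.
- move=> x k; move: x; apply/(holds_acyclic A)/holdsA/holds_acyclic => x.
  by rewrite omega_iter; lia.
- have numeral n : @eval _ N 0 (@of_ord0 N) (iter n tSucc tZero) = iter n g z.
    by elim: n => [|n IHn] /=; [congr fint; apply: funext => -[] | rewrite IHn].
  move=> n; split=> [Rn|Sn].
    apply: contrapT => nSn; have : holds N (fNot (R_numeral n)).
      by apply: modN; left; right; exists n.
    by apply; rewrite /= numeral.
  have : holds N (R_numeral n) by apply: modN; left; left; exists n.
  by rewrite /holds /= numeral.
Qed.

(** * Successor functions with a local graph *)

Section LocalSuccessor.
Variables (S : set nat) (r : nat) (g : nat -> nat) (z : nat).
Hypothesis recS : recurrent S.
Hypothesis g_local : forall s x x' y y', local_iso S r s ->
  (x, x') \in s -> (y, y') \in s -> g x = y <-> g x' = y'.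
Hypothesis g_inj : injective g.
Hypothesis g_range : forall y, y <> z <-> exists x, g x = y.
Hypothesis g_acyclic : forall x k, iter k.+1 g x <> x.

Lemma local_succ_tends (B : nat) : exists X, forall x, X < x -> B < g x.
Proof.
elim: B => [|B [X IHX]].
  have [[x0 eq_x0]|nex] := pselect (exists x, g x = 0).
    exists x0 => x lt_x; rewrite lt0n -eq_x0; apply/eqP => /g_inj; lia.
  by exists 0 => x _; rewrite lt0n; apply/eqP => eq_x; apply: nex; exists x.
have [[x0 eq_x0]|nex] := pselect (exists x, g x = B.+1).
  exists (X + x0) => x lt_x; have := IHX x.
  have : g x <> B.+1 by rewrite -eq_x0 => /g_inj; lia.
  lia.
exists X => x lt_x; have := IHX x lt_x.
have : g x <> B.+1 by move=> eq_x; apply: nex; exists x.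
lia.
Qed.

(** If [g x] were far from [x], a distant copy [y'] of its window would give a local isomorphism
    fixing [x] and moving [g x] to [y'], so [g x] would have two values. *)
Lemma local_succ_near (x : nat) : r < x -> r < g x -> g x <= x + r /\ x <= g x + r.
Proof.
move=> lt_x lt_gx; apply: contrapT => far.
have [y' lt_y' wind] := recS (x + g x + r) (ltnW lt_gx).
have iso : local_iso S r [:: (0, 0); (x, x); (g x, y')].
  split=> [|a a' b b'|a a']; rewrite // !inE.
    move=> /or3P[]/eqP[-> ->] /or3P[]/eqP[-> ->]; lia.
  move=> /or3P[]/eqP[-> ->] // y y'' eq_y _ _; suff -> : y = y'' by []; lia.
have := (g_local iso (x := x) (x' := x) (y := g x) (y' := y')).
rewrite !inE !eqxx !orbT => /(_ isT isT) [/(_ erefl) eq_g _]; lia.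
Qed.

(** As [g x] is within [r] of [x], its [r] window lies in the [2 * r] window of [x], and both points
    can be translated together. *)
Lemma local_succ_shift (x x' : nat) :
  2 * r < x -> 2 * r < x' -> r < g x -> same_window S (2 * r) x x' ->
  g x' + x = g x + x'.
Proof.
move=> lt_x lt_x' lt_gx wind.
have [near1 near2] : g x <= x + r /\ x <= g x + r by apply: local_succ_near; lia.
pose y' := g x + x' - x.
have iso : r < y' -> local_iso S r [:: (0, 0); (x, x'); (g x, y')].
  move=> lt_y'; split=> [|a a' b b'|a a']; rewrite // !inE.
    move=> /or3P[]/eqP[-> ->] /or3P[]/eqP[-> ->]; rewrite /y'; lia.
  move=> /or3P[]/eqP[-> ->] y y'' eq_y H1 H2.
  - by suff -> : y = y'' by []; lia.
  - by apply: wind; lia.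
  - by apply: wind; rewrite /y' in eq_y; lia.
have [|lt_y'] := leqP y' r; first by rewrite /y'; lia.
have := (g_local (iso lt_y') (x := x) (x' := x') (y := g x) (y' := y')).
rewrite !inE !eqxx !orbT => /(_ isT isT) [/(_ erefl) eq_g _].
by rewrite eq_g /y'; lia.
Qed.

(* In a long run where [S] is empty, [g] is a translation. Since [g] omits only
   [z], counting the points on either side of the run makes the shift [1]. *)
Lemma local_succ_cut : exists X, forall p, X < p ->
  (forall y, p <= y + 5 * r -> y <= p + 5 * r -> ~ S y) ->
  forall x, g x <= p -> x < p.
Proof.
have [X0 [ge_X0 tends]] : exists X, 10 * r <= X /\ forall x, X < x -> r < g x.
  have [X tends] := local_succ_tends r.
  by exists (X + 10 * r); split=> [|x lt_x]; [|apply: tends]; lia.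
(* This keeps [z] and the uncontrolled values of [g] up to [X0] below [g p]. *)
exists (X0 + \max_(x < X0.+1) g x + z + 10 * r) => p lt_p run.
have g_small x : x <= X0 -> g x <= \max_(x < X0.+1) g x.
  move=> le_x; have lt_x : x < X0.+1 by [].
  exact: (@leq_bigmax _ (fun i : 'I_X0.+1 => g i) (Ordinal lt_x)).
have near x : X0 < x -> g x <= x + r /\ x <= g x + r.
  by move=> lt_x; apply: local_succ_near; [|apply: tends]; lia.
(* The [2 * r] windows of these points stay within [5 * r] of [p], where [S] is empty. *)
have shift x : p <= x + 3 * r -> x <= p + 3 * r -> g x + p = g p + x.
  move=> le1 le2; apply: local_succ_shift; [lia|lia|apply: tends; lia|].
  move=> y y' eq_y H1 H2.
  by split=> Sy; [case: (run y)|case: (run y')]; lia || exact: Sy.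
have near_p : g p <= p + r /\ p <= g p + r by apply: near; lia.
have lt_g x : x < p -> g x < g p.
  move=> lt_x; have [/g_small|lt_X0] := leqP x X0; first lia.
  have [far|close] := ltnP (x + 3 * r) p; last by have := shift x; lia.
  by have := near x; lia.
have preim x : g x < g p -> x < p.
  move=> lt_gx; rewrite ltnNge; apply/negP => le_px.
  have [far|close] := ltnP (p + 3 * r) x; last by have := shift x; lia.
  by have := near x; lia.
(* The numbers below [g p] are [z] and the images of the numbers below [p]. *)
have eq_gp : p.+1 = g p.
  have : perm_eq (z :: [seq g x | x <- iota 0 p]) (iota 0 (g p)).
    apply: uniq_perm (iota_uniq _ _) _.
      rewrite /= map_inj_uniq // iota_uniq andbT; apply/mapP => -[x _ eq_z].
      by have /g_range : exists y, g y = z by exists x.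
    move=> y; rewrite inE mem_iota add0n; apply/orP/idP => [[/eqP->|/mapP[x]]|lt_y].
    - lia.
    - by rewrite mem_iota => lt_x ->; apply: lt_g.
    - have [->|/eqP/g_range[x eq_x]] := eqVneq y z; [by left|right].
      apply/mapP; exists x => //; rewrite mem_iota.
      by apply: preim; rewrite eq_x.
  by move=> /perm_size; rewrite /= size_map !size_iota.
by move=> x le_gx; apply: preim; lia.
Qed.

Lemma local_succ_prefix : exists X, forall p, X < p ->
  (forall y, p <= y + 5 * r -> y <= p + 5 * r -> ~ S y) ->
  iter p g z = p /\ perm_eq [seq iter j g z | j <- iota 0 p] (iota 0 p).
Proof.
have [X cut] := local_succ_cut; exists X => p lt_p run.
apply: orbit_prefix => // [y /eqP/g_range //|x k|]; last exact: cut.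
by apply/eqP/g_acyclic.
Qed.
End LocalSuccessor.

(** * Counting between two successive blocks *)

Lemma zero_run (n y : nat) :
  block_start n <= y -> y.+1 < block_start n + n -> ~ S0 y /\ ~ S1 y.
Proof.
move=> le_y lt_y; rewrite -(subnKC le_y).
have lt_n : n < 2 ^ n by rewrite ltn_expl.
by rewrite S0_cyclic_block ?S1_cyclic_block ?cyclic_block_small; try nia.
Qed.

Definition charf (X : set nat) (x : nat) : nat := `[< X x >].

Lemma sum_S1_prefix (n C : nat) : C < n ->
  \sum_(0 <= x < block_start n + C) charf S1 x =
  \sum_(0 <= x < block_start n) charf S1 x.
Proof.
move=> lt_C; rewrite (big_cat_nat (n := block_start n)) ?leq_addr //=.
rewrite [X in _ + X]big_nat_cond [X in _ + X]big1 ?addn0 // => x.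
rewrite andbT => /andP[le_x lt_x].
by rewrite /charf asboolF //; case: (@zero_run n x) => //; lia.
Qed.

(** Both bounds move back to the block starts across zeros of [S1]; the extra 1 is the separator. *)
Lemma sum_S1_block (n C : nat) : C < n ->
  \sum_(block_start n + C <= x < block_start n.+1 + C) charf S1 x =
  (\sum_(0 <= t < 2 ^ n * n) cyclic_block n t).+1.
Proof.
move=> lt_C; have n_gt0 : 0 < n by lia.
have le_start : block_start n <= block_start n.+1 by rewrite block_startS //; lia.
apply: (@addnI (\sum_(0 <= x < block_start n + C) charf S1 x)).
rewrite -big_cat_nat //=; last lia.
rewrite !sum_S1_prefix //; last lia.
rewrite (big_cat_nat (n := block_start n)) //=; congr (_ + _).
rewrite -{1}[block_start n]add0n big_addn block_startS // addKn.
rewrite big_nat_recr //= addnC [2 ^ n * n + _]addnC /charf S1_separator //.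
rewrite asboolT // add1n; congr _.+1; apply: eq_big_nat => t lt_t.
by rewrite addnC S1_cyclic_block // asboolb.
Qed.

(* [R] is read off the windows of the cyclic block, and the only window that is
   counted twice lies in the run that follows the separator. *)
Lemma dvdn_sum_block (R : set nat) (C n : nat) :
  (forall x x', C < x -> C < x' -> same_window S0 C x x' -> R x <-> R x') ->
  2 * C + 3 < n -> ~ R (block_start n + C) ->
  n %| \sum_(block_start n + C <= x < block_start n.+1 + C) charf R x.
Proof.
move=> R_local lt_C nR; have n_gt0 : 0 < n by lia.
have start_n := leq_block_start n.
(* By locality, all points beyond [C] that show the window [u] agree on [R]. *)
pose G (u : nat -> bool) : nat :=
  `[< exists x, [/\ C < x, forall i, i <= 2 * C -> S0 (x - C + i) <-> u i & R x] >].
have charfE t : t <= 2 ^ n * n ->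
    charf R (t + (block_start n + C)) = G (fun i => cyclic_block n (t + i)).
  move=> le_t; have S0_win i : i <= 2 * C ->
      S0 (t + (block_start n + C) - C + i) = cyclic_block n (t + i).
    by move=> le_i; rewrite -S0_cyclic_block; [congr S0|]; lia.
  congr (nat_of_bool _); apply: asbool_equiv_eq; split=> [Rx|[x [lt_x win Rx]]].
    by exists (t + (block_start n + C)); split=> [|i le_i|//]; [lia|rewrite S0_win].
  apply: (proj1 (R_local x _ lt_x _ _)) Rx; first lia.
  move=> y y' eq_y le1 le2; have le_i : y + C - x <= 2 * C by lia.
  have := win _ le_i; rewrite -S0_win //.
  have -> : x - C + (y + C - x) = y by lia.
  have -> : t + (block_start n + C) - C + (y + C - x) = y' by lia.
  by [].
rewrite -{1}[block_start n + C]add0n big_addn block_startS //.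
have -> : block_start n + (2 ^ n * n).+1 + C - (block_start n + C) = (2 ^ n * n).+1.
  by lia.
(* The last term sees the same window as the first one, at [block_start n + C], where [R] fails. *)
rewrite big_nat_recr //= charfE //.
have -> : (fun i => cyclic_block n (2 ^ n * n + i)) = (fun i => cyclic_block n (0 + i)).
  by apply: funext => i; rewrite addnC cyclic_block_period.
rewrite -charfE // /charf asboolF // addn0.
under eq_big_nat => t /andP[_ lt_t] do rewrite -/(charf R _) charfE ?(ltnW lt_t) //.
apply: dvdn_window_sum => u u' eq_u; congr (nat_of_bool _).
apply: asbool_equiv_eq; split=> -[x [lt_x win Rx]]; exists x; split=> // i le_i.
  by rewrite -eq_u ?win //; lia.
by rewrite eq_u ?win //; lia.
Qed.

Theorem theorem3 : ~ definitionally_equivalent (T_of S0) (T_of S1).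
Proof.
move=> /definable_model def.
have [F [P [modN defF defP]]] := def _ (model_T_of_omega (S := S0)).
have [] := model_T_of_interp modN => /=.
set z := F _ _; pose g x := F succ_sym (fun=> x); pose R := [set x | P tt (fun=> x)].
rewrite -/g -/(R _) => g_inj g_range g_acyclic R_numeral.
have [phi phiP] := defF succ_sym; have [psi psiP] := defP tt.
have [r1 phi_local] := sat_local phi recurrent_S0.
have [r2 psi_local] := sat_local psi recurrent_S0.
(* The radius [r] serves both formulas, and [5 * r] is the half-length of run asked for by
   [local_succ_prefix]. *)
pose r := r1 + r2; pose C := 5 * r.
have g_local s x x' y y' : local_iso S0 r s ->
    (x, x') \in s -> (y, y') \in s -> g x = y <-> g x' = y'.
  move=> iso sx sy; rewrite !phiP.
  apply: phi_local => [|i]; first by apply: local_iso_le iso; lia.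
  case: (unliftP ord0 i) => [j ->|->]; first by rewrite !scons_lift.
  by rewrite !scons_ord0.
have R_local x x' : C < x -> C < x' -> same_window S0 C x x' -> R x <-> R x'.
  move=> lt_x lt_x' win; rewrite /R /= !psiP.
  apply: (psi_local [:: (0, 0); (x, x')]) => [|i]; last by rewrite !inE eqxx orbT.
  split=> [|a a' b b'|a a']; rewrite // !inE.
    by move=> /orP[]/eqP[-> ->] /orP[]/eqP[-> ->]; lia.
  move=> /orP[]/eqP[-> ->] y y' eq_y H1 H2; last by apply: win; lia.
  by suff -> : y = y' by []; lia.
have [X prefix] := local_succ_prefix recurrent_S0 g_local g_inj g_range g_acyclic.
pose n := X + 10 * C + 4.
(* All points within [C] of [p] lie in the initial zeros of block [m]. *)
have orbit m : n <= m -> let p := block_start m + C in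
    iter p g z = p /\ perm_eq [seq iter j g z | j <- iota 0 p] (iota 0 p).
  move=> le_nm; apply: prefix => [|y le1 le2].
    by have := leq_block_start m; lia.
  by case: (@zero_run m y) => //; lia.
have sumR m : n <= m -> \sum_(0 <= x < block_start m + C) charf R x =
    \sum_(0 <= x < block_start m + C) charf S1 x.
  move=> /orbit[_ perm]; rewrite /index_iota subn0 -(perm_big _ perm) big_map.
  by apply: eq_bigr => j _; congr (nat_of_bool _); apply: asbool_equiv_eq (R_numeral j).
have nR : ~ R (block_start n + C).
  have [<- _] := orbit n (leqnn n); rewrite [R _]R_numeral.
  by case: (@zero_run n (block_start n + C)) => //; lia.
have := dvdn_sum_block R_local _ nR; rewrite (_ : _ < n); last lia.
move=> /(_ isT).
(* Subtract the equal prefix counts at blocks [n] and [n + 1]. *)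
have -> : \sum_(block_start n + C <= x < block_start n.+1 + C) charf R x =
    \sum_(block_start n + C <= x < block_start n.+1 + C) charf S1 x.
  apply: (@addnI (\sum_(0 <= x < block_start n + C) charf R x)).
  have le_start : block_start n + C <= block_start n.+1 + C.
    by rewrite block_startS; lia.
  rewrite -big_cat_nat // sumR; last lia.
  by rewrite sumR // -big_cat_nat.
rewrite sum_S1_block; last lia.
(* Reading just the first letter of each window shows that [n] divides the number of ones in the
   cyclic block, so [n] would divide 1, although it is at least 4. *)
rewrite -addn1 dvdn_addr; last first.
  have := @dvdn_window_sum n (fun u => u 0); under eq_bigr do rewrite addn0.
  by apply=> u u' ->; lia.
by rewrite dvdn1; lia.
Qed.
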